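(* Let $\mathcal{S}$ be an operator system. Then the identity map from $\operatorname{OMIN}(\mathcal{S})$ to $\mathcal{S}$ is completely bounded with $\|\operatorname{id}\|_{cb} =C$ if and only if for every operator system $\mathcal{T}$, every unital positive linear map from $\mathcal{T}$ into $\mathcal{S}$ is completely bounded and the supremum of the completely bounded norms of all such maps (over all $\mathcal{T}$) is $C$.
   Context: An (abstract) operator system is a triple $(V,\{C_n\}_{n\ge1},e)$: $V$ is a complex vector space with conjugate-linear involution $*$ (and $M_n(V)$ has involution $(a_{i,j})^*=(a_{j,i}^* )$); $C_n=M_n(V)^+$ are cones in $M_n(V)_h$ (hermitian elements) with $C_n\cap-C_n=\{0\}$ and $X^*C_nX\subseteq C_m$ for all $X\in M_{n,m}(\mathbb{C})$; and $e\in V_h$ is such that, for each $n$, $e_n=\operatorname{diag}(e,\dots,e)$ is an Archimedean order unit for $(M_n(V),C_n)$ (for each hermitian $A$ there is $r>0$ with $re_n-A\in C_n$; and $re_n+A\in C_n$ for all $r>0$ implies $A\in C_n$). By the Choi–Effros theorem every operator system is unitally completely order isomorphic to a concrete one (a $*$-closed subspace of some $B(H)$ containing $I$), and it thereby carries a canonical operator space structure, namely $\|A\|_{M_n(V)}=\inf\{t>0:\begin{pmatrix} te_n & A \\ A^* & te_n \end{pmatrix}\in C_{2n}\}$. Completely bounded norms are with respect to these matrix norms: $\|\phi\|_{cb}=\sup_n\|\phi_n\|$, $\phi_n((v_{i,j}))=(\phi(v_{i,j}))$. A linear map is positive if it maps the first-level cone into the first-level cone, and unital if it maps unit to unit. $\operatorname{OMIN}(\mathcal{S})$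 is the operator system with the same underlying $*$-vector space and unit as $\mathcal{S}$ and cones $C_n^{\min}(\mathcal{S})=\{(v_{i,j})\in M_n(\mathcal{S}):\sum_{i,j}\overline{\lambda_i}\lambda_jv_{i,j}\in\mathcal{S}^+\ \forall\lambda_1,\dots,\lambda_n\in\mathbb{C}\}$, where $\mathcal{S}^+$ is the first-level cone of $\mathcal{S}$. *)

(* Defs.v *)
From HB Require Import structures.
From mathcomp Require Import all_boot all_order all_algebra.
From mathcomp Require Import complex.
From mathcomp Require Import all_classical all_reals ereal.

Set Implicit Arguments.
Unset Strict Implicit.
Unset Printing Implicit Defensive.

Import Order.TTheory GRing.Theory Num.Theory.

Local Open Scope classical_set_scope.
Local Open Scope complex_scope.
Local Open Scope ring_scope.

Section MatricesOverVectorSpace.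
Variables (R : realType) (V : lmodType R[i]).

Definition mxstar (star : V -> V) m n (A : 'M[V]_(m, n)) : 'M[V]_(n, m) :=
  (map_mx star A)^T.

(* X^* A X for a scalar matrix X; *m is not available, the entries of A being
   vectors. *)
Definition mxcongr n m (X : 'M[R[i]]_(n, m)) (A : 'M[V]_n) : 'M[V]_m :=
  \matrix_(k, l) \sum_i \sum_j ((X i k)^* * X j l) *: A i j.

Definition qform n (lam : 'I_n -> R[i]) (A : 'M[V]_n) : V :=
  \sum_i \sum_j ((lam i)^* * lam j) *: A i j.

End MatricesOverVectorSpace.

(* Only the levels n >= 1 of mcone are meaningful, mcone 0 is unconstrained.
   As a matrix, e%:M is diag(e, ..., e). *)
Record opSystem (R : realType) := OpSystem {
  carrier :> lmodType R[i];
  star : carrier -> carrier;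
  mcone : forall n, set 'M[carrier]_n;
  ounit : carrier;
  starK : involutive star;
  starD : forall x y, star (x + y) = star x + star y;
  starZ : forall (a : R[i]) x, star (a *: x) = a^* *: star x;
  mcone_herm : forall n, (0 < n)%N ->
    forall A, @mcone n A -> mxstar star A = A;
  mcone0 : forall n, (0 < n)%N -> @mcone n 0;
  mconeD : forall n, (0 < n)%N ->
    forall A B, @mcone n A -> @mcone n B -> @mcone n (A + B);
  mconeZ : forall n, (0 < n)%N ->
    forall t : R, 0 <= t -> forall A, @mcone n A ->
    @mcone n (map_mx (fun v => t%:C *: v) A);
  mcone_proper : forall n, (0 < n)%N ->
    forall A, @mcone n A -> @mcone n (- A) -> A = 0;
  mcone_congr : forall n m, (0 < n)%N -> (0 < m)%N ->
    forall (X : 'M[R[i]]_(n, m)) A, @mcone n A -> @mcone m (mxcongr X A);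
  ounit_herm : star ounit = ounit;
  ounit_order : forall n, (0 < n)%N -> forall A, mxstar star A = A ->
    exists2 r : R, 0 < r & @mcone n ((r%:C *: ounit)%:M - A);
  ounit_archi : forall n, (0 < n)%N -> forall A : 'M[carrier]_n,
    (forall r : R, 0 < r -> @mcone n ((r%:C *: ounit)%:M + A)) -> @mcone n A
}.

Arguments star {R} _ _.
Arguments mcone {R} _ {n} _.
Arguments ounit {R} _.

Section OperatorSystems.
Variable R : realType.
Implicit Types S T : opSystem R.

Definition poscone S : set S := [set v | mcone S (const_mx v : 'M_1)].

Definition mxnorm S n (A : 'M[S]_n) : R :=
  inf [set t : R | 0 < t /\
    mcone S (block_mx (t%:C *: ounit S)%:M A
                      (mxstar (star S) A) (t%:C *: ounit S)%:M)].

(* The operator norm of the n-th amplification of phi. *)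
Definition ampnorm T S (phi : T -> S) n : \bar R :=
  ereal_sup [set (mxnorm (map_mx phi A))%:E
            | A in [set A : 'M[T]_n | mxnorm A <= 1]].

Definition cbnorm T S (phi : T -> S) : \bar R :=
  ereal_sup [set ampnorm phi n | n in [set n | (0 < n)%N]].

Definition completely_bounded T S (phi : T -> S) : Prop :=
  (cbnorm phi < +oo)%E.

Definition positive_map T S (phi : T -> S) : Prop :=
  forall v, poscone v -> poscone (phi v).

Definition unital_map T S (phi : T -> S) : Prop := phi (ounit T) = ounit S.

Definition cmin S n : set 'M[S]_n :=
  [set A | forall lam : 'I_n -> R[i], poscone (qform lam A)].

End OperatorSystems.

Section QForm.
Variables (R : realType) (V : lmodType R[i]).
Implicit Types (n : nat).

Lemma qformD n (lam : 'I_n -> R[i]) (A B : 'M[V]_n) :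
  qform lam (A + B) = qform lam A + qform lam B.
Proof.
rewrite /qform -big_split; apply: eq_bigr => i _ /=.
by rewrite -big_split; apply: eq_bigr => j _ /=; rewrite mxE scalerDr.
Qed.

Lemma qform0 n (lam : 'I_n -> R[i]) : qform lam (0 : 'M[V]_n) = 0.
Proof.
by rewrite /qform big1 // => i _; rewrite big1 // => j _; rewrite mxE scaler0.
Qed.

Lemma qformN n (lam : 'I_n -> R[i]) (A : 'M[V]_n) :
  qform lam (- A) = - qform lam A.
Proof. by apply/eqP; rewrite -addr_eq0 -qformD addNr qform0. Qed.

Lemma qformZ n (lam : 'I_n -> R[i]) a (A : 'M[V]_n) :
  qform lam (map_mx (fun v => a *: v) A) = a *: qform lam A.
Proof.
rewrite /qform scaler_sumr; apply: eq_bigr => i _; rewrite scaler_sumr.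
by apply: eq_bigr => j _; rewrite mxE !scalerA mulrC.
Qed.

Lemma qform_scalar n (lam : 'I_n -> R[i]) (v : V) :
  qform lam v%:M = (\sum_i (lam i)^* * lam i) *: v.
Proof.
rewrite /qform scaler_suml; apply: eq_bigr => i _.
rewrite (bigD1 i) //= big1 ?addr0 ?mxE ?eqxx // => j ji.
by rewrite mxE eq_sym (negPf ji) mulr0n scaler0.
Qed.

Lemma qform_mxcongr n (lam : 'I_n -> R[i]) (A : 'M[V]_n) :
  const_mx (qform lam A) = mxcongr (\col_i lam i) A :> 'M[V]_1.
Proof.
apply/matrixP => k l; rewrite !mxE.
by apply: eq_bigr => i _; apply: eq_bigr => j _; rewrite !mxE.
Qed.

Lemma qform_congr n m (X : 'M[R[i]]_(n, m)) (lam : 'I_m -> R[i]) (A : 'M[V]_n) :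
  qform lam (mxcongr X A) = qform (fun i => \sum_k X i k * lam k) A.
Proof.
transitivity (\sum_k \sum_l \sum_i \sum_j
  (((lam k)^* * lam l) * ((X i k)^* * X j l)) *: A i j).
  rewrite /qform; apply: eq_bigr => k _; apply: eq_bigr => l _.
  rewrite mxE scaler_sumr; apply: eq_bigr => i _; rewrite scaler_sumr.
  by apply: eq_bigr => j _; rewrite scalerA.
transitivity (\sum_i \sum_j \sum_k \sum_l
  (((lam k)^* * lam l) * ((X i k)^* * X j l)) *: A i j).
  under eq_bigr do rewrite exchange_big /=.
  rewrite exchange_big /=; apply: eq_bigr => i _.
  under eq_bigr do rewrite exchange_big /=.
  by rewrite exchange_big.
apply: eq_bigr => i _; apply: eq_bigr => j _.
rewrite rmorph_sum /= mulr_suml scaler_suml; apply: eq_bigr => k _.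
rewrite mulr_sumr scaler_suml; apply: eq_bigr => l _.
by rewrite rmorphM /= mulrACA [(lam k)^* * _]mulrC [lam l * _]mulrC.
Qed.

Lemma qform_two n (k l : 'I_n) (c : R[i]) (A : 'M[V]_n) : k != l ->
  qform (fun i => if i == k then 1 else if i == l then c else 0) A =
  A k k + c *: A k l + (c^* *: A l k + (c^* * c) *: A l l).
Proof.
move=> kl; have lk : l == k = false by rewrite eq_sym (negPf kl).
have E (G : 'I_n -> V) : (forall i, i != k -> i != l -> G i = 0) ->
    \sum_i G i = G k + G l.
  move=> G0; rewrite (bigD1 k) //= (bigD1 l) ?lk //= big1 ?addr0 //.
  by move=> i /andP[ik il]; apply: G0.
rewrite /qform E; last first.
  move=> i /negPf ik /negPf il; rewrite ik il rmorph0.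
  by rewrite big1 // => j _; rewrite mul0r scale0r.
rewrite !E ?eqxx ?lk ?rmorph1 ?mul1r ?mulr1 ?scale1r //;
  by move=> j /negPf jk /negPf jl; rewrite jk jl mulr0 scale0r.
Qed.

Lemma qform_one n (k : 'I_n) (A : 'M[V]_n) :
  qform (fun i => if i == k then 1 else 0) A = A k k.
Proof.
rewrite /qform (bigD1 k) //= [X in _ + X]big1 ?addr0; last first.
  move=> i /negPf ik; rewrite ik rmorph0.
  by rewrite big1 // => j _; rewrite mul0r scale0r.
rewrite (bigD1 k) //= big1 ?addr0 ?eqxx ?rmorph1 ?mul1r ?scale1r //.
by move=> j /negPf jk; rewrite jk mulr0 scale0r.
Qed.

Lemma qform_eq0 n (A : 'M[V]_n) : (forall lam, qform lam A = 0) -> A = 0.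
Proof.
move=> A0; have Ad k : A k k = 0 by rewrite -qform_one.
apply/matrixP => k l; rewrite mxE; have [->|kl] := eqVneq k l; first exact: Ad.
have := A0 (fun i => if i == k then 1 else if i == l then 1 else 0).
have := A0 (fun i => if i == k then 1 else if i == l then 'i else 0).
rewrite !qform_two // !Ad !scaler0 !addr0 !add0r rmorph1 !scale1r.
rewrite conjCi scaleNr -scalerBr => /eqP; rewrite scaler_eq0 => /orP[|].
  by rewrite (negPf (neq0Ci _)).
rewrite subr_eq0 => /eqP <- /eqP.
by rewrite -mulr2n -scaler_nat scaler_eq0 pnatr_eq0 /= => /eqP.
Qed.

End QForm.

Section OMIN.
Variables (R : realType) (S : opSystem R).
Implicit Types (n : nat).

Lemma star_is0 : star S 0 = 0.
Proof. by apply: (addrI (star S 0)); rewrite -starD !addr0. Qed.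

Lemma starN x : star S (- x) = - star S x.
Proof. by apply/eqP; rewrite -addr_eq0 -starD addNr star_is0. Qed.

Lemma star_sum I (r : seq I) (F : I -> S) :
  star S (\sum_(i <- r) F i) = \sum_(i <- r) star S (F i).
Proof. exact: (big_morph (star S) (starD (o:=S)) star_is0). Qed.

Lemma star_qform n (lam : 'I_n -> R[i]) (A : 'M[S]_n) :
  star S (qform lam A) = qform lam (mxstar (star S) A).
Proof.
rewrite /qform star_sum exchange_big; apply: eq_bigr => j _ /=.
rewrite star_sum; apply: eq_bigr => i _.
by rewrite !mxE starZ rmorphM /= conjCK mulrC.
Qed.

Lemma pos_star v : poscone v -> star S v = v.
Proof. by move=> /mcone_herm-/(_ isT)/matrixP/(_ 0 0); rewrite !mxE. Qed.

Lemma mcone_qform n (lam : 'I_n -> R[i]) (A : 'M[S]_n) : (0 < n)%N ->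
  mcone S A -> poscone (qform lam A).
Proof. by move=> n0 AS; rewrite /poscone /= qform_mxcongr; apply: mcone_congr. Qed.

Lemma cmin_herm n (A : 'M[S]_n) : cmin A -> mxstar (star S) A = A.
Proof.
move=> A0; apply/eqP; rewrite -subr_eq0; apply/eqP/qform_eq0 => lam.
by rewrite qformD qformN -star_qform (pos_star (A0 lam)) subrr.
Qed.

Lemma cmin0 n : cmin (0 : 'M[S]_n).
Proof. by move=> lam; rewrite qform0; exact: mcone0. Qed.

Lemma posD v w : poscone v -> poscone w -> poscone (v + w : S).
Proof.
rewrite /poscone /= => v0 w0.
have -> : const_mx (v + w) = const_mx v + const_mx w :> 'M[S]_1.
  by apply/matrixP => i j; rewrite !mxE.
exact: mconeD.
Qed.

Lemma posZ (t : R) v : 0 <= t -> poscone v -> poscone (t%:C *: v : S).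
Proof.
move=> t0 v0; rewrite /poscone /=.
have -> : const_mx (t%:C *: v) =
    map_mx (fun v => t%:C *: v) (const_mx v) :> 'M[S]_1.
  by apply/matrixP => i j; rewrite !mxE.
exact: mconeZ.
Qed.

Lemma cminD n (A B : 'M[S]_n) : cmin A -> cmin B -> cmin (A + B).
Proof. by move=> A0 B0 lam; rewrite qformD; exact: posD. Qed.

Lemma cminZ n (t : R) (A : 'M[S]_n) : 0 <= t -> cmin A ->
  cmin (map_mx (fun v => t%:C *: v) A).
Proof. by move=> t0 A0 lam; rewrite qformZ; exact: posZ. Qed.

Lemma cmin_proper n (A : 'M[S]_n) : cmin A -> cmin (- A) -> A = 0.
Proof.
move=> A0 NA0; apply: qform_eq0 => lam.
have /matrixP/(_ 0 0) : const_mx (qform lam A) = 0 :> 'M[S]_1.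
  apply: mcone_proper => //; first exact: A0.
  have -> : - const_mx (qform lam A) = const_mx (qform lam (- A)) :> 'M[S]_1.
    by apply/matrixP => i j; rewrite qformN !mxE.
  exact: NA0.
by rewrite !mxE.
Qed.

Lemma cmin_congr n m (X : 'M[R[i]]_(n, m)) (A : 'M[S]_n) :
  cmin A -> cmin (mxcongr X A).
Proof. by move=> A0 lam; rewrite qform_congr. Qed.

Lemma cmin_order n (A : 'M[S]_n) : (0 < n)%N -> mxstar (star S) A = A ->
  exists2 r : R, 0 < r & cmin ((r%:C *: ounit S)%:M - A).
Proof.
move=> n0 /(ounit_order n0)[r r0 rA]; exists r => // lam.
exact: mcone_qform.
Qed.

Lemma sum_normE n (lam : 'I_n -> R[i]) :
  exists2 s : R, 0 <= s & \sum_i (lam i)^* * lam i = s%:C.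
Proof.
have : 0 <= \sum_i (lam i)^* * lam i.
  by apply: sumr_ge0 => i _; rewrite mulrC mul_conjC_ge0.
case: (\sum_i _) => a b; rewrite lecE /= => /andP[/eqP -> a0].
by exists a.
Qed.

Lemma cmin_archi n (A : 'M[S]_n) :
  (forall r : R, 0 < r -> cmin ((r%:C *: ounit S)%:M + A)) -> cmin A.
Proof.
move=> rA lam; apply: ounit_archi => // r r0.
have [s s0 sE] := sum_normE lam.
have u0 : poscone (ounit S).
  have /(ounit_order (ltn0Sn 0))[t t0] : mxstar (star S) 0 = 0 :> 'M[S]_1.
    by apply/matrixP => i j; rewrite !mxE star_is0.
  rewrite subr0 => tu.
  rewrite -[ounit S]scale1r -(rmorph1 (real_complex R)) -(mulVf (lt0r_neq0 t0)).
  rewrite rmorphM /= -scalerA; apply: posZ; first by rewrite invr_ge0 ltW.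
  rewrite /poscone /=; congr (mcone S _): tu.
  by apply/matrixP => i j; rewrite !mxE !ord1.
have s1 : 0 < s + 1 by rewrite ltr_wpDl.
have rs0 : 0 < r / (s + 1) by rewrite divr_gt0.
have := rA _ rs0 lam; rewrite qformD qform_scalar sE => H.
have -> : (r%:C *: ounit S)%:M + const_mx (qform lam A) =
   const_mx ((r / (s + 1))%:C *: ounit S +
     (s%:C *: ((r / (s + 1))%:C *: ounit S) + qform lam A)) :> 'M[S]_1.
  apply/matrixP => i j; rewrite !mxE !ord1 eqxx mulr1n addrA; congr (_ + _).
  rewrite scalerA -scalerDl -rmorphM -rmorphD /=; congr (_%:C *: _).
  by rewrite -[X in X + _]mul1r -mulrDl addrC mulrCA divff ?mulr1 ?lt0r_neq0.
apply: posD => //; apply: posZ => //; exact: ltW.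
Qed.

Definition OMIN : opSystem R :=
  @OpSystem R S (star S) (@cmin R S) (ounit S)
    (@starK R S) (@starD R S) (@starZ R S)
    (fun n _ => @cmin_herm n) (fun n _ => @cmin0 n) (fun n _ => @cminD n)
    (fun n _ t t0 A => @cminZ n t A t0) (fun n _ => @cmin_proper n)
    (fun n m _ _ => @cmin_congr n m) (@ounit_herm R S)
    (fun n gt0 A => @cmin_order n A gt0) (fun n _ => @cmin_archi n).

Definition id_OMIN : OMIN -> S := fun v => v.

End OMIN.

Arguments OMIN {R} S.
Arguments id_OMIN {R} S _.

(* Main.v *)
Require Import Defs.
From mathcomp Require Import all_boot all_order all_algebra.
From mathcomp Require Import complex.
From mathcomp Require Import all_classical all_reals ereal.

(** The identity OMIN(S) -> S is itself unital and positive, so it competes in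
    the supremum.  Conversely, a unital positive map phi : T -> S is completely
    positive as a map into OMIN(S), hence completely contractive, so that phi
    factors as a complete contraction followed by the identity and
    ||phi||_cb <= ||id||_cb.  Thus the supremum always equals ||id||_cb. *)

Local Open Scope classical_set_scope.
Local Open Scope ring_scope.

Import Order.TTheory GRing.Theory Num.Theory.

Lemma poscone_ounit_sub (R : realType) (T : opSystem R) (v : T) :
  star T v = v -> exists r : R, poscone (r%:C%C *: ounit T - v).
Proof.
move=> vh.
have /(ounit_order (ltn0Sn 0))[r _ rv] :
    mxstar (star T) (const_mx v) = const_mx v :> 'M[T]_1.
  by apply/matrixP => i j; rewrite !mxE.
exists r; rewrite /poscone /=; congr (mcone T _): rv.
by apply/matrixP => i j; rewrite !mxE !ord1 eqxx mulr1n.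
Qed.

(** Keeps [mxnorm] from being the default infimum of an empty set: the order unit at level [n + n]
    dominates the hermitian matrix with off-diagonal blocks [- A] and its adjoint. *)
Lemma mxnorm_set_neq0 (R : realType) (T : opSystem R) n (A : 'M[T]_n) :
  (0 < n)%N ->
  [set t : R | 0 < t /\
    mcone T (block_mx (t%:C%C *: ounit T)%:M A
                      (mxstar (star T) A) (t%:C%C *: ounit T)%:M)] !=set0.
Proof.
move=> n0.
have B_herm : mxstar (star T) (block_mx 0 (- A) (- mxstar (star T) A) 0) =
    block_mx 0 (- A) (- mxstar (star T) A) 0.
  rewrite {1}/mxstar map_block_mx tr_block_mx; congr block_mx;
    by apply/matrixP => i j; rewrite !mxE ?star_is0 // starN ?starK.
have [r r0 rB] := @ounit_order R T _ (ltn_addl n n0) _ B_herm.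
exists r; split=> //; congr (mcone T _): rB.
by rewrite scalar_mx_block opp_block_mx add_block_mx !oppr0 !opprK !add0r !addr0.
Qed.

Section UnitalPositiveMaps.
Variables (R : realType) (T S : opSystem R) (phi : {linear T -> S}).

Lemma linear_qform n (lam : 'I_n -> R[i]) (A : 'M[T]_n) :
  phi (qform lam A) = qform lam (map_mx phi A).
Proof.
rewrite /qform linear_sum; apply: eq_bigr => i _.
by rewrite linear_sum; apply: eq_bigr => j _; rewrite linearZ mxE.
Qed.

Hypotheses (phi1 : unital_map phi) (phi_pos : positive_map phi).

(** Membership in [cmin] is tested on the vectors [qform lam], which lie at level one and commute
    with [phi]; so first-level positivity is enough. *)
Lemma positive_cmin n (A : 'M[T]_n) : (0 < n)%N ->
  mcone T A -> cmin (map_mx phi A).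
Proof.
by move=> n0 A0 lam; rewrite -linear_qform; apply/phi_pos/mcone_qform.
Qed.

(** For some real r, r e - v is positive, so its image r e - phi v is hermitian; r e is hermitian
    too. *)
Lemma positive_star_herm v : star T v = v -> star S (phi v) = phi v.
Proof.
move=> /poscone_ounit_sub[r /phi_pos/pos_star].
rewrite linearB linearZ phi1 starD starN starZ ounit_herm.
have -> : (r%:C%C)^* = r%:C%C by apply/CrealP/complex_realP; exists r.
by move=> /addrI/oppr_inj.
Qed.

Lemma positive_star v : phi (star T v) = star S (phi v).
Proof.
have /positive_star_herm : star T (v + star T v) = v + star T v.
  by rewrite starD starK addrC.
have /positive_star_herm : star T ('i *: (v - star T v)) = 'i *: (v - star T v).
  by rewrite starZ starD starN starK conjCi scaleNr -scalerN opprB.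
rewrite linearZ linearB linearD starZ !starD starN conjCi scaleNr -scalerN opprB.
move=> /(scalerI (neq0Ci _)) E1 E2.
have : 2%:R *: phi (star T v) = 2%:R *: star S (phi v).
  have twice (x y : S) : 2%:R *: y = (x + y) - (x - y).
    by rewrite opprB [RHS]addrC addrA subrK scaler_nat mulr2n.
  rewrite (twice (phi v)) -E1 -E2 (twice (star S (phi (star T v)))).
  by congr (_ - _); rewrite addrC.
by move=> /scalerI; apply; rewrite pnatr_eq0.
Qed.

Lemma mxnorm_positive n (A : 'M[T]_n) : (0 < n)%N ->
  mxnorm (map_mx phi A : 'M[OMIN S]_n) <= mxnorm A.
Proof.
move=> n0; rewrite /mxnorm; apply: lb_le_inf; first exact: mxnorm_set_neq0.
(* Each t admissible for [A] is admissible for its image: apply [phi] to the whole block matrix, at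
   level [n + n]. *)
move=> t [t0 /(positive_cmin _ _ (ltn_addl n n0)) tA].
apply: ge_inf; first by exists 0 => s [/ltW].
split=> //; congr (cmin _): tA.
rewrite map_block_mx; congr block_mx; apply/matrixP => i j; rewrite !mxE.
- by rewrite raddfMn /= linearZ phi1.
- by rewrite positive_star.
- by rewrite raddfMn /= linearZ phi1.
Qed.

Lemma cbnorm_positive_le : (cbnorm phi <= cbnorm (id_OMIN S))%E.
Proof.
apply: ge_ereal_sup => _ [n n0 <-].
apply: (@le_trans _ _ (ampnorm (id_OMIN S) n)); last first.
  by apply: ereal_sup_ubound; exists n.
apply: ge_ereal_sup => _ [A A1 <-]; apply: ereal_sup_ubound.
(* The image of [A] lies in the unit ball of [OMIN S], and the identity carries it unchanged into
   [S]. *)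
exists (map_mx phi A); first exact: le_trans (mxnorm_positive _ _ n0) A1.
by rewrite map_mx_id.
Qed.

End UnitalPositiveMaps.

Lemma positive_id_OMIN (R : realType) (S : opSystem R) :
  positive_map (id_OMIN S).
Proof.
(* At level one the test vector 1 recovers v itself. *)
move=> v /(_ (fun=> 1)); rewrite /qform !big_ord1 mxE rmorph1 mulr1 scale1r.
exact.
Qed.

Lemma ereal_sup_cbnorm (R : realType) (S : opSystem R) :
  ereal_sup [set x : \bar R | exists (T : opSystem R) (phi : {linear T -> S}),
    [/\ unital_map phi, positive_map phi & x = cbnorm phi]] =
  cbnorm (id_OMIN S).
Proof.
apply/eqP; rewrite eq_le; apply/andP; split.
  by apply: ge_ereal_sup => _ [T [phi [phi1 phi_pos ->]]]; apply: cbnorm_positive_le.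
apply: ereal_sup_ubound; exists (OMIN S), (idfun : {linear S -> S}).
by split=> //; apply: positive_id_OMIN.
Qed.

Theorem proposition5p3 (R : realType) (S : opSystem R) (C : R) :
  (completely_bounded (id_OMIN S) /\ cbnorm (id_OMIN S) = C%:E) <->
  ((forall (T : opSystem R) (phi : {linear T -> S}),
      unital_map phi -> positive_map phi -> completely_bounded phi) /\
   ereal_sup [set x : \bar R | exists (T : opSystem R) (phi : {linear T -> S}),
      [/\ unital_map phi, positive_map phi & x = cbnorm phi]] = C%:E).
Proof.
rewrite ereal_sup_cbnorm; split=> -[id_cb idC]; split=> //.
  by move=> T phi phi1 phi_pos; apply: le_lt_trans id_cb; apply: cbnorm_positive_le.
by rewrite /completely_bounded idC ltry.
Qed.
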